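(* Let $G$ be a finitely generated group and let $A$ be any finite symmetric generating set of $G$. For every $D\ge 0$, the language $L_D\subseteq A^\star$ consisting of all words which label $D$-super-contracting geodesics in the Cayley graph $\mathrm{Cay}(G,A)$ is a regular language.
   Context: $\mathrm{Cay}(G,A)$ is the graph with vertex set $G$, with $g,h$ joined by an edge if $g^{-1}h\in A$ (edge from $g$ to $h$ labeled $g^{-1}h$), made into a metric space by giving each edge length $1$. $A^\star$ is the free monoid on $A$; a word $w\in A^\star$ determines the edge path in $\mathrm{Cay}(G,A)$ starting at the identity $e$ and labeled by the letters of $w$ from left to right. The word $w$ is a $D$-super-contracting geodesic (an element of $L_D$) if this path is a $D$-super-contracting geodesic. For a closed subset $C$ of a proper geodesic metric space $X$ and $x\in X$, the projection is $\pi_C(x)=\{p\in C : d(x,p)=\min_{y\in C} d(x,y)\}$, and $\pi_C(B)=\bigcup_{x\in B}\pi_C(x)$ for $B\subseteq X$. A path is identified with its image. A geodesic $\alpha$ is $D$-super-contracting if for every subsegment $\gamma\subseteq\alpha$ and every closed metric ball $B$ disjoint from $\gamma$, $\operatorname{diam}(\pi_\gamma(B))\le D$. A finite state automaton over $A$ is a finite directed graph with edges labeled by elements of $A$, whose vertices are partitioned into ''accept'' and ''reject'' vertices, with a distinguished initial vertex $s_0$; its accepted language is the set of words that label a directed edge path from $s_0$ to an accept vertex. A language over $A$ is regular if it is the accepted language of some finite state automaton over $A$. *)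

(* Defs.v *)
From HB Require Import structures.
From mathcomp Require Import all_boot all_order all_algebra finmap.
From mathcomp Require Import all_classical all_reals all_analysis.
From mathcomp Require Import ring.

Set Implicit Arguments.
Unset Strict Implicit.
Unset Printing Implicit Defensive.

Import Order.TTheory GRing.Theory Num.Theory.

Local Open Scope classical_set_scope.
Local Open Scope ring_scope.

Section MetricGeometry.
Context {R : realType} {X : metricType R}.
Implicit Types (C B : set X) (c : R -> X).

(* The library's [closed_ball] is the closure of an open ball, which differs
   from this set in general. *)
Definition metric_closed_ball (x : X) (r : R) : set X :=
  [set y | mdist x y <= r].

Definition proj_point C (x : X) : set X :=
  [set p | C p /\ forall y, C y -> mdist x p <= mdist x y].

Definition proj_set C B : set X := \bigcup_(x in B) proj_point C x.

(* The supremum over the empty set is [-oo]. *)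
Definition diam B : \bar R :=
  ereal_sup [set (mdist p.1 p.2)%:E | p in B `*` B].

(* Paths are functions on [R], of which only the values on [0, l] matter. *)
Definition geodesic c (l : R) : Prop :=
  forall s t, 0 <= s <= l -> 0 <= t <= l -> mdist (c s) (c t) = `|s - t|.

Definition super_contracting (D : R) c (l : R) : Prop :=
  forall a b, 0 <= a -> a <= b -> b <= l ->
  let gamma := c @` [set t | a <= t <= b] in
  forall (x : X) (r : R), 0 <= r ->
  metric_closed_ball x r `&` gamma = set0 ->
  (diam (proj_set gamma (metric_closed_ball x r)) <= D%:E)%E.

End MetricGeometry.

Definition symmetric_subset (G : groupType) (A : {fset G}) : Prop :=
  forall a, a \in A -> (a^-1)%g \in A.

Definition generates (G : groupType) (A : {fset G}) : Prop :=
  forall H : {pred G}, group_closed H -> {subset A <= H} -> forall g, g \in H.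

Section CayleyGraph.
Context (R : realType) (G : groupType).
Implicit Types (A : {fset G}) (g h : G) (s t : R).

(* Points of the Cayley graph are given by barycentric coordinates: the point
   at parameter t of the edge from g to h is the function (1 - t) g + t h on
   the vertex set. In particular the edge from g to h and its reverse have the
   same points, and a loop (when the identity is in A) is reduced to its
   vertex. *)
Definition edge_point g h t : G -> R :=
  fun v => (1 - t) * (v == g)%:R + t * (v == h)%:R.

Definition vertex_point g : G -> R := fun v => (v == g)%:R.

Definition closed_edge g h : set (G -> R) :=
  [set edge_point g h t | t in [set t | 0 <= t <= 1]].

Definition cayley_adjacent A g h : bool := (g^-1 * h)%g \in A.

Definition realization A : set (G -> R) :=
  [set x | (exists g, x = vertex_point g) \/
           (exists g h, cayley_adjacent A g h /\ closed_edge g h x)].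

(* [genA] is a parameter because the path metric below is finite only if the
   graph is connected. *)
Record cayley A (genA : generates A) := CayleyPoint {
  bary : G -> R ;
  baryP : bary \in realization A }.

Section Metric.
Context A (genA : generates A).
Local Notation X := (cayley genA).
Implicit Types x y z : X.

HB.instance Definition _ := [isSub for @bary A genA].
HB.instance Definition _ := [Choice of X by <:].

(* [pl_length x y l]: some piecewise linear path from x to y has length l. On
   an edge from g to h <> g, the points with parameters s and t have distance
   |s - t|, which is also the absolute difference of their coordinates at g. *)
Inductive pl_length : X -> X -> R -> Prop :=
| pl_nil x : pl_length x x 0
| pl_step x y z g h l :
    cayley_adjacent A g h ->
    closed_edge g h (bary x) -> closed_edge g h (bary y) ->
    pl_length y z l -> pl_length x z (`|bary x g - bary y g| + l).

Definition cayley_dist x y : R := inf [set l | pl_length x y l].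

Lemma bary_cayley x : realization A (bary x).
Proof. by have := baryP x; rewrite inE. Qed.

Lemma vertex_subproof g : vertex_point g \in realization A.
Proof. by rewrite inE; left; exists g. Qed.

Definition vertex g : X := CayleyPoint genA (vertex_subproof g).

Lemma edge_point0 g h : edge_point g h 0 = vertex_point g.
Proof.
by apply/funext => v; rewrite /edge_point subr0 mul1r mul0r addr0.
Qed.

Lemma edge_point1 g h : edge_point g h 1 = vertex_point h.
Proof.
by apply/funext => v; rewrite /edge_point subrr mul1r mul0r add0r.
Qed.

Lemma closed_edge0 g h : closed_edge g h (vertex_point g).
Proof. by exists 0; rewrite ?edge_point0 //= lexx ler01. Qed.

Lemma closed_edge1 g h : closed_edge g h (vertex_point h).
Proof. by exists 1; rewrite ?edge_point1 //= lexx ler01. Qed.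

Lemma edge_coord_le g h s t v :
  `|edge_point g h s v - edge_point g h t v| <=
  `|edge_point g h s g - edge_point g h t g|.
Proof.
have E u : edge_point g h s u - edge_point g h t u =
           (t - s) * ((u == g)%:R - (u == h)%:R).
  rewrite /edge_point; ring.
rewrite !E !normrM ler_wpM2l// eqxx.
have [<-|gh] := eqVneq g h; first by rewrite !subrr normr0.
rewrite subr0 normr1.
have [->|vg] := eqVneq v g; first by rewrite (negbTE gh) subr0 normr1.
by rewrite sub0r normrN; case: (v == h); rewrite ?normr1 ?normr0.
Qed.

Lemma pl_length_ge_coord x y l v :
  pl_length x y l -> `|bary x v - bary y v| <= l.
Proof.
elim=> {x y l} [x|x y z g h l _ [s _ Ex] [t _ Ey] _ IH].
  by rewrite subrr normr0.
apply: le_trans (ler_distD (bary y v) _ _) _.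
by apply: lerD => //; rewrite -Ex -Ey edge_coord_le.
Qed.

Lemma pl_length_ge0 x y l : pl_length x y l -> 0 <= l.
Proof.
by move=> Pl; apply: le_trans (pl_length_ge_coord 1%g Pl); exact: normr_ge0.
Qed.

Lemma pl_length_cat x y z l m :
  pl_length x y l -> pl_length y z m -> pl_length x z (l + m).
Proof.
elim=> {x y l} [x|x y u g h l gh ex ey _ IH] /=; first by rewrite add0r.
by move=> /IH Pl; rewrite -addrA; exact: pl_step gh ex ey Pl.
Qed.

Lemma pl_length_rev x y l : pl_length x y l -> pl_length y x l.
Proof.
elim=> {x y l} [x|x y z g h l gh ex ey _ IH]; first exact: pl_nil.
rewrite addrC; apply: pl_length_cat IH _.
by rewrite distrC -[X in pl_length _ _ X]addr0; exact: pl_step gh ey ex (pl_nil _).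
Qed.

Lemma pl_length_vertices g h : exists l, pl_length (vertex g) (vertex h) l.
Proof.
pose H : {pred G} := fun u => `[< forall g,
  exists l, pl_length (vertex g) (vertex (g * u)%g) l >].
suff /asboolP/(_ g)[l] : (g^-1 * h)%g \in H.
  by rewrite mulVKg => ?; exists l.
apply: genA; first split.
- by apply/asboolP => k; exists 0; rewrite mulg1; exact: pl_nil.
- move=> u v /asboolP Hu /asboolP Hv; apply/asboolP => k.
  have [l Pl] := Hu k; have [m Pm] := Hv (k * (u / v))%g.
  exists (l + m); apply: pl_length_cat Pl _; apply: pl_length_rev.
  by rewrite -mulgA mulgVK in Pm.
move=> a aA; apply/asboolP => k.
eexists; apply: (@pl_step _ (vertex (k * a)%g) _ k (k * a)%g).
- by rewrite /cayley_adjacent mulKg.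
- exact: closed_edge0.
- exact: closed_edge1.
- exact: pl_nil.
Qed.

Lemma pl_length_vertex x : exists g l, pl_length x (vertex g) l.
Proof.
have [[g xg]|[g [h [gh e]]]] := bary_cayley x.
  exists g, 0; rewrite (_ : x = vertex g); first exact: pl_nil.
  exact: val_inj.
by exists g; eexists; apply: (pl_step gh e _ (pl_nil _)); exact: closed_edge0.
Qed.

Lemma pl_length_nonempty x y : [set l | pl_length x y l] !=set0.
Proof.
have [g [l Pl]] := pl_length_vertex x; have [h [m Pm]] := pl_length_vertex y.
have [k Pk] := pl_length_vertices g h.
exists (l + (k + m)); apply: pl_length_cat Pl _; apply: pl_length_cat Pk _.
exact: pl_length_rev.
Qed.

Lemma pl_length_has_inf x y : has_inf [set l | pl_length x y l].
Proof.
split; first exact: pl_length_nonempty.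
by exists 0 => l /=; exact: pl_length_ge0.
Qed.

Lemma cayley_dist_le x y l : pl_length x y l -> cayley_dist x y <= l.
Proof. by move=> Pl; apply: ge_inf => //; case: (pl_length_has_inf x y). Qed.

Lemma cayley_dist_ge x y b :
  (forall l, pl_length x y l -> b <= l) -> b <= cayley_dist x y.
Proof. by move=> Hb; apply: lb_le_inf => //; exact: pl_length_nonempty. Qed.

Lemma cayley_distxx x : cayley_dist x x = 0.
Proof.
apply/eqP; rewrite eq_le cayley_dist_le ?cayley_dist_ge//; last exact: pl_nil.
by move=> l; exact: pl_length_ge0.
Qed.

Lemma cayley_dist_eq0 x y : cayley_dist x y = 0 -> x = y.
Proof.
move=> d0; apply: val_inj; apply/funext => v /=.
apply/eqP; rewrite -subr_eq0 -normr_le0 -d0; apply: cayley_dist_ge => l.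
exact: pl_length_ge_coord.
Qed.

Lemma cayley_dist_sym x y : cayley_dist x y = cayley_dist y x.
Proof.
by apply/eqP; rewrite eq_le; apply/andP; split; apply: cayley_dist_ge => l Pl;
  apply: cayley_dist_le; exact: pl_length_rev.
Qed.

Lemma cayley_dist_triangle y x z :
  cayley_dist x z <= cayley_dist x y + cayley_dist y z.
Proof.
rewrite -lerBlDr; apply: cayley_dist_ge => l Pl.
rewrite lerBlDl -lerBlDr; apply: cayley_dist_ge => m Pm.
by rewrite lerBlDr addrC; apply: cayley_dist_le; exact: pl_length_cat Pl Pm.
Qed.

HB.instance Definition _ := isMetric.Build R X
  cayley_distxx cayley_dist_eq0 cayley_dist_sym cayley_dist_triangle.

(* The vertex reached from the identity after the first i letters of w. *)
Definition word_vertex (w : seq A) (i : nat) : G :=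
  (\prod_(a <- take i w) val a)%g.

(* The edge path of w, each letter taking unit time, on [0, size w]. There the
   default value of [insubd] is not used (see [word_pathE]). *)
Definition word_path (w : seq A) (t : R) : X :=
  let i := Num.truncn t in
  insubd (vertex 1%g)
    (edge_point (word_vertex w i) (word_vertex w i.+1) (t - i%:R)).

Lemma word_pathE (w : seq A) (t : R) : 0 <= t <= (size w)%:R ->
  let i := Num.truncn t in
  bary (word_path w t) =
  edge_point (word_vertex w i) (word_vertex w i.+1) (t - i%:R).
Proof.
move=> /andP[t0 tw] i; rewrite /word_path -/i.
suff R_ : edge_point (word_vertex w i) (word_vertex w i.+1) (t - i%:R)
       \in realization A.
  by rewrite (_ : bary _ = val (insubd (vertex 1%g) (edge_point
    (word_vertex w i) (word_vertex w i.+1) (t - i%:R))))// val_insubd R_.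
have /andP[it ti] : i%:R <= t < i.+1%:R by exact: truncn_itv.
rewrite inE.
have [iw|wi] := ltnP i (size w); last first.
  left; exists (word_vertex w i); rewrite (_ : t - i%:R = 0) ?edge_point0//.
  by apply/eqP; rewrite subr_eq0 eq_le it (le_trans tw)// ler_nat.
right; exists (word_vertex w i), (word_vertex w i.+1); split; last first.
  exists (t - i%:R) => //=; rewrite subr_ge0 it/= lerBlDr -natr1 addrC in ti *.
  by rewrite ltW// addrC.
case: w iw {tw} => [//|a0 w] iw.
rewrite /cayley_adjacent /word_vertex (take_nth a0)// -cats1 big_cat big_seq1 /=.
by rewrite mulKg; exact: valP.
Qed.

End Metric.

Definition super_contracting_language A (genA : generates A) (D : R) :
    set (seq A) :=
  [set w | geodesic (word_path genA w) (size w)%:R /\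
           super_contracting D (word_path genA w) (size w)%:R].

End CayleyGraph.

Arguments cayley R {G A} genA.
Arguments vertex_point R {G} g.
Arguments realization R {G} A.
Arguments vertex R {G A} genA g.

Section Automata.
Context {T : finType}.

Record automaton := Automaton {
  state : finType ;
  edge : state -> T -> state -> bool ;
  initial : state ;
  accept : {pred state} }.

Fixpoint labels_path (M : automaton) (s : state M) (w : seq T) (s' : state M) :
    Prop :=
  if w is a :: w' then exists2 u, edge s a u & labels_path u w' s' else s = s'.

Definition accepted_language (M : automaton) : set (seq T) :=
  [set w | exists2 s, s \in @accept M & labels_path (initial M) w s].

Definition regular_language (L : set (seq T)) : Prop :=
  exists M : automaton, L = accepted_language M.

End Automata.

(* Main.v *)
(* Super-contraction is a local property, with the same constant. A ball violating
   it contains points projecting to both endpoints p, q of a subsegment longer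
   than D; let y be the one projecting to q. If the part [p, n] short of the last
   edge is super-contracting, then y projects to [p, n] within D of p. Paths
   leave a contracting geodesic near the projection of their endpoint, so
   d(y, q) exceeds the distance from y to [p, n] unless d(p, q) <= 3 D + 10.
   Hence for a geodesic word only its subwords of bounded length matter.
   Moreover a geodesic with nearly the same endpoints as a contracting one stays
   near it, so that Cannon's cone-type argument applies: which words extend w to
   a geodesic in L_D is determined by the last letters of w and the set of
   elements h of a fixed ball with |gh| < |g|, where g is the endpoint of w.
   Hence L_D has finitely many residuals. *)
Require Import Defs.
From HB Require Import structures.
From mathcomp Require Import all_boot all_order all_algebra finmap.
From mathcomp Require Import all_classical all_reals all_analysis.
From mathcomp Require Import zify ring lra.

Set Implicit Arguments.
Unset Strict Implicit.
Unset Printing Implicit Defensive.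

Import Order.TTheory GRing.Theory Num.Theory.
Import numFieldNormedType.Exports.

Local Open Scope classical_set_scope.
Local Open Scope ring_scope.

(** * Contraction of geodesics in a metric space *)

Section Contracting.
Context {R : realType} {X : metricType R}.
Implicit Types (c : R -> X) (x y z P Q : X) (a b l r s t D : R).

Local Notation seg c a b := (c @` [set t | a <= t <= b]).

(** Normal form of a failure of contraction: the two projections are exactly the ends of the
    segment. *)
Definition obstruction c a b : Prop := exists z r x y,
  [/\ 0 <= r, metric_closed_ball z r `&` seg c a b = set0,
      mdist z x <= r, mdist z y <= r &
      proj_point (seg c a b) x (c a) /\ proj_point (seg c a b) y (c b)].

Lemma super_contracting_mdist D c l a b z r x y P Q :
  super_contracting D c l -> 0 <= a -> a <= b -> b <= l -> 0 <= r ->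
  metric_closed_ball z r `&` seg c a b = set0 ->
  mdist z x <= r -> mdist z y <= r ->
  proj_point (seg c a b) x P -> proj_point (seg c a b) y Q ->
  mdist P Q <= D.
Proof.
move=> sc a0 ab bl r0 zr zx zy xP yQ.
rewrite -lee_fin; apply: le_trans (sc a b a0 ab bl z r r0 zr).
apply: ereal_sup_ubound; exists (P, Q) => //; split.
  by exists x.
by exists y.
Qed.

Lemma geodesic_mdist c l s t :
  geodesic c l -> 0 <= s -> s <= t -> t <= l -> mdist (c s) (c t) = t - s.
Proof.
by move=> gc s0 st tl; rewrite gc; [rewrite distrC ger0_norm; lra|lra|lra].
Qed.

Lemma proj_point_sub c a b a' b' x s :
  a <= a' -> b' <= b -> a' <= s <= b' ->
  proj_point (seg c a b) x (c s) -> proj_point (seg c a' b') x (c s).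
Proof.
move=> aa bb ss [_ xs]; split; first by exists s.
move=> _ [t /andP[at_ tb] <-]; apply: xs; exists t => //=.
by rewrite (le_trans aa at_) (le_trans tb bb).
Qed.

Lemma disjoint_seg_sub c a b a' b' z r : a <= a' -> b' <= b ->
  metric_closed_ball z r `&` seg c a b = set0 ->
  metric_closed_ball z r `&` seg c a' b' = set0.
Proof.
move=> aa bb H; rewrite -subset0 -H; apply: setIS.
move=> _ [t /andP[at_ tb] <-]; exists t => //=.
by rewrite (le_trans aa at_) (le_trans tb bb).
Qed.

(** Cutting a segment down to the piece between two projection points keeps the ball disjoint from
    it and both points projecting as before. *)
Lemma super_contractingP D c l : geodesic c l ->
  super_contracting D c l <->
  (forall a b, 0 <= a -> a <= b -> b <= l -> D < b - a -> ~ obstruction c a b).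
Proof.
move=> gc; split=> [sc a b a0 ab bl Dab [z [r [x [y [r0 zr zx zy [xP yP]]]]]]|no].
  have := super_contracting_mdist sc a0 ab bl r0 zr zx zy xP yP.
  by rewrite (geodesic_mdist gc); lra.
move=> a b a0 ab bl gamma z r r0 zr; apply: ge_ereal_sup => _ [[P Q] [/= HP HQ] <-].
have ordered s t x y : a <= s -> s <= t -> t <= b -> mdist z x <= r ->
    mdist z y <= r -> proj_point gamma x (c s) -> proj_point gamma y (c t) ->
    mdist (c s) (c t) <= D.
  move=> as_ st tb zx zy xs yt.
  rewrite leNgt; apply/negP; rewrite (geodesic_mdist gc); try lra.
  move=> Dst; apply: (no s t _ st _ Dst); try lra.
  exists z, r, x, y; split => //; first exact: disjoint_seg_sub zr.
  by split; [apply: proj_point_sub xs|apply: proj_point_sub yt]; lra.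
rewrite lee_fin.
case: HP HQ => x /= zx [[s /= sab <-] xs] [y /= zy [[t /= tab <-] yt]].
move: zx zy; rewrite /metric_closed_ball /= => zx zy.
have [st|/ltW ts] := leP s t; first
  by apply: (ordered s t x y) => //;
    [lra|lra|split=> //; exists s|split=> //; exists t].
by rewrite metric_sym; apply: (ordered t s y x) => //;
  [lra|lra|split=> //; exists t|split=> //; exists s].
Qed.

Lemma super_contracting_eq D c c' l : (forall t, 0 <= t <= l -> c t = c' t) ->
  super_contracting D c l -> super_contracting D c' l.
Proof.
move=> cc' sc a b a0 ab bl; have := sc a b a0 ab bl.
have -> // : seg c a b = seg c' a b.
by apply: eq_imagel => t /= tab; apply: cc'; lra.
Qed.

Lemma geodesic_proj_point c l a b x : geodesic c l ->
  0 <= a -> a <= b -> b <= l ->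
  exists s, a <= s <= b /\ proj_point (seg c a b) x (c s).
Proof.
move=> gc a0 ab bl.
have cf : {within `[a, b], continuous (fun t => mdist x (c t))}.
  apply/subspace_continuousP => s; rewrite /= in_itv /= => sab.
  apply/cvgrPdist_le => e e0; apply/nbhs_ballP; exists e => //= t st.
  rewrite in_itv /= => tab.
  have ct : mdist (c s) (c t) <= e by rewrite gc; [exact: ltW|lra|lra].
  have := metric_triangle x (c t) (c s); have := metric_triangle x (c s) (c t).
  rewrite (metric_sym (c t) (c s)) ler_distl /from_subspace /= => H1 H2; lra.
have [s sab sP] := EVT_min ab cf; rewrite in_itv /= in sab.
exists s; split => //; split; first by exists s.
by move=> _ [t tab <-]; apply: sP; rewrite in_itv.
Qed.

(* Holds in every geodesic space with [2] replaced by [0]; the slack saves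
   proving that the infimum in [cayley_dist] is attained. *)
Definition coarsely_geodesic : Prop := forall x z r, 0 <= r <= mdist x z ->
  exists u, mdist x u <= r /\ mdist u z <= mdist x z - r + 2.

(* One moves from [y] towards [c s] in steps of length [mdist y P - 1]: each of
   them stays in a ball disjoint from the segment, so it moves the projection by
   at most [D], which the decrease of the distance to [c s] pays for as long as
   the distance to the segment exceeds [D + 3]. *)
Lemma contracting_reverse_triangle D c l a b y P s :
  coarsely_geodesic -> geodesic c l -> super_contracting D c l -> 0 <= D ->
  0 <= a -> a <= b -> b <= l -> a <= s <= b -> proj_point (seg c a b) y P ->
  mdist y P + mdist P (c s) <= mdist y (c s) + (D *+ 2 + 8).
Proof.
move=> cg gc sc D0 a0 ab bl sab.
have [n] : exists n, mdist y (c s) <= n%:R.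
  exists (Num.truncn (mdist y (c s))).+1; exact/ltW/truncnS_gt.
elim: n y P => [|n IH] y P yn [Pc yP].
  have yP0 : mdist y P <= mdist y (c s) by apply: yP; exists s.
  have := metric_triangle P y (c s); rewrite (metric_sym P y); lra.
have yP0 : mdist y P <= mdist y (c s) by apply: yP; exists s.
(* In the first case the left side is at most [mdist y (c s)] plus twice [mdist y P]; the constant
   2D + 8 comes from here. *)
have [small|big] := leP (mdist y P) (D + 4).
  have := metric_triangle P y (c s); rewrite (metric_sym P y); lra.
have [|y1 [yy1 y1s]] := cg y (c s) (mdist y P - 1); first lra.
have [t [_ y1t]] := geodesic_proj_point y1 gc a0 ab bl.
have Pt : mdist P (c t) <= D.
  apply: (super_contracting_mdist sc a0 ab bl _ _ _ yy1 (conj Pc yP) y1t).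
  - lra.
  - rewrite -subset0 => u [yu /yP yPu]; rewrite /metric_closed_ball /= in yu.
    lra.
  - by rewrite mdistxx; lra.
have := metric_triangle P (c t) (c s).
have [near_|far] := leP (mdist y1 (c t)) (D + 3).
  have := metric_triangle (c t) y1 (c s); rewrite (metric_sym (c t) y1); lra.
have := IH y1 (c t) _ y1t; rewrite -natr1 in yn; lra.
Qed.

Lemma super_contracting_extend D c l l' :
  coarsely_geodesic -> geodesic c l -> 0 <= D -> 0 <= l' -> l' <= l ->
  l <= l' + 1 -> super_contracting D c l' ->
  (forall a b, 0 <= a -> a <= b -> b <= l -> l' < b -> D < b - a ->
    b - a <= D *+ 3 + 10 -> ~ obstruction c a b) ->
  super_contracting D c l.
Proof.
move=> cg gc D0 l'0 l'l ll' sc short; apply/(super_contractingP _ gc).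
move=> a b a0 ab bl Dab ob.
have gc' : geodesic c l' by move=> s t sl tl; apply: gc; lra.
have [bl'|l'b] := leP b l'.
  by move/(super_contractingP _ gc'): sc => /(_ a b a0 ab bl' Dab).
have [/(short a b a0 ab bl l'b Dab)//|long] := leP (b - a) (D *+ 3 + 10).
have al' : a <= l' by lra.
have [z [r [x [y [r0 zr zx zy [xa yb]]]]]] := ob.
have [s [sal ys]] := geodesic_proj_point y gc' a0 al' (lexx l').
have aa : a <= a <= l' by rewrite lexx.
have las : mdist (c a) (c s) <= D.
  apply: (super_contracting_mdist sc a0 al' _ r0 _ zx zy _ ys) => //.
    by apply: disjoint_seg_sub zr => //; lra.
  by apply: proj_point_sub xa => //; lra.
have lal' : a <= l' <= l' by rewrite al' lexx.
(* Along [c] it is at most D from [a] to [s], at most 2D + 9 from [s] to [l'] and at most 1 from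
   [l'] to [b], in all 3D + 10. *)
have := contracting_reverse_triangle cg gc' sc D0 a0 al' (lexx l') lal' ys.
have yb_s : mdist y (c b) <= mdist y (c s) by apply: yb.2; exists s => //=; lra.
have := metric_triangle y (c b) (c l').
rewrite (metric_sym (c b)) !(geodesic_mdist gc) in las *; lra.
Qed.

(** An obstruction is expressed by distances alone, so an isometric map carries it along. The shift
    [s] relates a word to its suffixes. *)
Lemma obstruction_transport (f : X -> X) c c' a b s :
  (forall x y, mdist (f x) (f y) = mdist x y) -> a <= b ->
  (forall t, a <= t <= b -> c' (t + s) = f (c t)) ->
  obstruction c a b -> obstruction c' (a + s) (b + s).
Proof.
move=> fd ab c'f [z [r [x [y [r0 zr zx zy [[_ xa] [_ yb]]]]]]].
have c'E t : a + s <= t <= b + s -> a <= t - s <= b /\ c' t = f (c (t - s)).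
  by move=> ts; rewrite -c'f; [split; [lra|congr c'; ring]|lra].
exists (f z), r, (f x), (f y); split; rewrite ?fd//.
  rewrite -subset0 => _ [/[swap] -[t /= /c'E[ts ->] <-]].
  rewrite /metric_closed_ball /= fd => zt.
  suff : (metric_closed_ball z r `&` seg c a b) (c (t - s)) by rewrite zr.
  by split=> //; exists (t - s).
split; split; first by exists (a + s) => //=; lra.
- move=> _ [t /= /c'E[ts ->] <-]; rewrite c'f ?fd; last lra.
  by apply: xa; exists (t - s).
- by exists (b + s) => //=; lra.
- move=> _ [t /= /c'E[ts ->] <-]; rewrite c'f ?fd; last lra.
  by apply: yb; exists (t - s).
Qed.

End Contracting.

Arguments coarsely_geodesic {R} X.

(** * Word length and Cannon's tails *)

Section WordLength.
Context (G : groupType) (A : {fset G}).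
Hypotheses (symA : symmetric_subset A) (genA : generates A).
Implicit Types (g h : G) (v w : seq A).

Definition word_val w : G := (\prod_(a <- w) val a)%g.

Lemma word_val_cat v w : word_val (v ++ w) = (word_val v * word_val w)%g.
Proof. exact: big_cat. Qed.

Lemma word_val_rcons w a : word_val (rcons w a) = (word_val w * val a)%g.
Proof. by rewrite -cats1 word_val_cat /word_val big_seq1. Qed.

Lemma word_val_inv w : exists v, word_val v = ((word_val w)^-1)%g.
Proof.
elim: w => [|a w [v IH]]; first by exists [::]; rewrite /word_val big_nil invg1.
exists (rcons v [` symA (valP a)]%fset).
by rewrite word_val_rcons IH /word_val big_cons invgM.
Qed.

(** The values of words form a subgroup containing [A]; symmetry of [A] supplies the inverses. *)
Lemma word_val_surj g : exists w, word_val w = g.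
Proof.
pose H : {pred G} := fun u => `[< exists w, word_val w = u >].
suff /asboolP : g \in H by [].
apply: genA; first split.
- by apply/asboolP; exists [::]; rewrite /word_val big_nil.
- move=> _ _ /asboolP[v <-] /asboolP[w <-]; apply/asboolP.
  have [w' ww'] := word_val_inv w.
  by exists (v ++ w'); rewrite word_val_cat ww'.
move=> a aA; apply/asboolP; exists [:: [` aA]%fset].
by rewrite /word_val big_seq1.
Qed.

Fact word_length_subproof g :
  exists n, `[< exists w, word_val w = g /\ size w = n >].
Proof.
by have [w <-] := word_val_surj g; exists (size w); apply/asboolP; exists w.
Qed.

Definition word_length g : nat := ex_minn (word_length_subproof g).

Lemma word_lengthP g : exists w, word_val w = g /\ size w = word_length g.
Proof. by rewrite /word_length; case: ex_minnP => n /asboolP. Qed.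

Lemma word_length_le w : (word_length (word_val w) <= size w)%N.
Proof.
rewrite /word_length; case: ex_minnP => n _; apply.
by apply/asboolP; exists w.
Qed.

Lemma word_lengthM g h : (word_length (g * h)%g <= word_length g + word_length h)%N.
Proof.
have [v [<- <-]] := word_lengthP g; have [w [<- <-]] := word_lengthP h.
by rewrite -size_cat -word_val_cat word_length_le.
Qed.

Lemma word_length1 : word_length 1%g = 0.
Proof.
by have := word_length_le [::]; rewrite /word_val big_nil leqn0 => /eqP.
Qed.

Lemma word_length_gen a : a \in A -> (word_length a <= 1)%N.
Proof.
by move=> aA; have := word_length_le [:: [` aA]%fset]; rewrite /word_val big_seq1.
Qed.

(** Cannon's tail: the elements of the ball of radius [K] that lead closer to the identity. Indexing
    them by words of length at most [K] makes the type of tails finite. *)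
Definition cone_tail K w : {ffun K.-bseq A -> bool} :=
  [ffun v : K.-bseq A =>
    (word_length (word_val w * word_val v)%g < word_length (word_val w))%N].

End WordLength.

(** * The path metric of the Cayley graph and the action of the group *)

Section CayleyMetric.
Context (R : realType) (G : groupType) (A : {fset G}).
Hypotheses (symA : symmetric_subset A) (genA : generates A).
Local Notation X := (cayley R genA).
Local Notation wl := (word_length symA genA).
Implicit Types (x y z : X) (g h k : G) (v w : seq A) (s t l : R).

Lemma mdist_cayleyE x y : mdist x y = cayley_dist x y.
Proof. by []. Qed.

Lemma mdist_pl x y l : pl_length x y l -> mdist x y <= l.
Proof. exact: cayley_dist_le. Qed.

Lemma mdist_edge x y g h s t : cayley_adjacent A g h ->
  bary x = edge_point g h s -> bary y = edge_point g h t ->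
  0 <= s <= 1 -> 0 <= t <= 1 -> mdist x y <= `|s - t|.
Proof.
move=> gh xs yt s01 t01.
apply: (@le_trans _ _ (`|bary x g - bary y g| + 0)).
  apply: mdist_pl; apply: (pl_step gh _ _ (pl_nil _)).
    by exists s.
  by exists t.
rewrite addr0 xs yt /edge_point eqxx /=.
rewrite (_ : _ - _ = (t - s) * (1 - (g == h)%:R)); last by ring.
rewrite normrM distrC -[leRHS]mulr1 ler_wpM2l//.
by case: (g == h); rewrite ?subrr ?subr0 ?normr0 ?normr1.
Qed.

(** The path is cut at the start of the step during which length [r] is exceeded; a step has length
    at most 1, hence the error term. *)
Lemma pl_length_split x z L r : pl_length x z L -> 0 <= r <= L ->
  exists u, mdist x u <= r /\ mdist u z <= L - r + 1.
Proof.
move=> xz; elim: xz r => {x z L} [x|x y z g h L gh ex ey yz IH] r.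
  by move=> r0; exists x; rewrite !mdistxx; lra.
have [xy1 xyL] : `|bary x g - bary y g| <= 1 /\ mdist x y <= `|bary x g - bary y g|.
  split.
    case: ex ey => s s01 <- [t t01 <-]; rewrite /edge_point /= in s01 t01 *.
    rewrite eqxx; case: (g == h); rewrite ler_distl /=; lra.
  by rewrite -[leRHS]addr0; apply: mdist_pl; exact: pl_step gh ex ey (pl_nil _).
move=> r0L; have [rxy|xyr] := ltP r `|bary x g - bary y g|.
  exists x; rewrite mdistxx; split; first lra.
  have := mdist_pl (pl_step gh ex ey yz); lra.
have [|u [yu uz]] := IH (r - `|bary x g - bary y g|); first lra.
exists u; have := metric_triangle x y u; lra.
Qed.

Lemma cayley_coarsely_geodesic : coarsely_geodesic X.
Proof.
(* A path within 1 of the infimum; cutting it costs another 1, which makes the slack 2. *)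
move=> x z r r0; have [L xzL Ld] := inf_adherent ltr01 (pl_length_has_inf x z).
have dL := mdist_pl xzL.
have [|u [xu uz]] := pl_length_split xzL (r := r); first lra.
by exists u; split=> //; rewrite -/(cayley_dist x z) -mdist_cayleyE in Ld; lra.
Qed.

(* The sum has at most two nonzero terms: this is the affine extension to the
   edges of the word length seen from [k]. *)
Definition extended_length k x : R :=
  \sum_(v \in [set: G]) bary x v * (wl (k^-1 * v)%g)%:R.

Lemma extended_length_vertex k g :
  extended_length k (vertex R genA g) = (wl (k^-1 * g)%g)%:R.
Proof.
rewrite /extended_length (fsbigTE [fset g]%fset) ?big_seq_fset1.
  by rewrite /= /vertex_point eqxx mul1r.
by move=> i; rewrite inE /= /vertex_point => /negbTE ->; rewrite mul0r.
Qed.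

(** On an edge the function is affine, and the word lengths at its ends differ by at most 1, in both
    directions because [A] is symmetric. *)
Lemma extended_length_lipschitz k x y g h : cayley_adjacent A g h ->
  closed_edge g h (bary x) -> closed_edge g h (bary y) ->
  `|extended_length k x - extended_length k y| <= `|bary x g - bary y g|.
Proof.
move=> gh [s s01 xs] [t t01 yt].
have E u r : edge_point g h r = bary u -> extended_length k u =
   (1 - r) * (wl (k^-1 * g)%g)%:R + r * (wl (k^-1 * h)%g)%:R.
  move=> ur; rewrite /extended_length -ur (fsbigTE [fset g; h]%fset).
    rewrite /edge_point; have [<-|gh'] := eqVneq g h.
      by rewrite fsetUid big_seq_fset1 eqxx /=; ring.
    rewrite big_fsetU1 ?inE//= big_seq_fset1 !eqxx.
    by rewrite [h == g]eq_sym (negbTE gh') /=; ring.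
  move=> i; rewrite !inE negb_or /edge_point => /andP[/negbTE -> /negbTE ->].
  by rewrite /=; ring.
rewrite (E _ _ xs) (E _ _ yt) -xs -yt /edge_point eqxx /=.
have [<-|gh'] := eqVneq g h.
  rewrite (_ : _ - _ = 0); last by ring.
  by rewrite normr0.
have step (u v : G) : cayley_adjacent A u v ->
    (wl (k^-1 * v)%g <= wl (k^-1 * u)%g + 1)%N.
  move=> uv; have -> : (k^-1 * v = k^-1 * u * (u^-1 * v))%g by rewrite -mulgA mulVKg.
  by apply: leq_trans (word_lengthM _ _ _ _) _; rewrite leq_add2l word_length_gen.
have nm := step _ _ gh.
have /step mn : cayley_adjacent A h g.
  by have := symA gh; rewrite invgM invgK.
move: nm mn; set m := (wl (k^-1 * g)%g); set n := (wl (k^-1 * h)%g) => nm mn.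
rewrite (_ : _ - _ = (t - s) * (m%:R - n%:R)); last by ring.
rewrite [X in _ <= `|X|](_ : _ = (t - s) * 1); last by rewrite /=; ring.
rewrite !normrM ler_wpM2l// normr1 ler_distl.
by move: nm mn; rewrite -!(ler_nat R) !natrD; lra.
Qed.

(** A shortest word gives a path, hence the upper bound. For the lower bound, [extended_length g]
    grows along a path by at most its length. *)
Lemma mdist_vertex g h :
  mdist (vertex R genA g) (vertex R genA h) = (wl (g^-1 * h)%g)%:R.
Proof.
apply/eqP; rewrite eq_le; apply/andP; split.
  have [w [wgh <-]] := word_lengthP symA genA (g^-1 * h)%g.
  have -> : h = (g * word_val w)%g by rewrite wgh mulVKg.
  elim/last_ind: w {wgh} => [|w a IH]; first
    by rewrite /word_val big_nil mulg1 mdistxx.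
  apply: le_trans (metric_triangle _ (vertex R genA (g * word_val w)%g) _) _.
  rewrite size_rcons -natr1 lerD// word_val_rcons mulgA.
  rewrite -(normr1 R) -[1]/(1 : R) -(subr0 1) distrC.
  apply: (mdist_edge (g := g * word_val w) (h := g * word_val w * val a)%g).
  - by rewrite /cayley_adjacent mulKg; exact: valP.
  - by rewrite edge_point0.
  - by rewrite edge_point1.
  - lra.
  - lra.
apply: cayley_dist_ge => l ghl.
rewrite -extended_length_vertex.
suff : forall x y, pl_length x y l ->
    extended_length g y - extended_length g x <= l.
  move=> /(_ _ _ ghl); rewrite [X in _ - X]extended_length_vertex mulVg.
  by rewrite word_length1 subr0.
move=> {ghl} x y; elim=> {x y l} [x|x y z k k' l kk' ex ey _ IH].
  by rewrite subrr.
have := extended_length_lipschitz g kk' ex ey; rewrite ler_norml; lra.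
Qed.

Lemma eq_mulVg k (u v : G) : ((k^-1 * v)%g == u) = (v == (k * u)%g).
Proof. by apply/eqP/eqP => [<-|->]; rewrite ?mulVKg ?mulKg. Qed.

Lemma edge_point_translate k g h t (v : G) :
  edge_point g h t (k^-1 * v)%g = edge_point (k * g)%g (k * h)%g t v.
Proof. by rewrite /edge_point !eq_mulVg. Qed.

Lemma cayley_adjacent_translate k g h :
  cayley_adjacent A (k * g)%g (k * h)%g = cayley_adjacent A g h.
Proof. by rewrite /cayley_adjacent invgM -mulgA mulKg. Qed.

Lemma translate_subproof k x :
  (fun u : G => bary x (k^-1 * u)%g) \in realization R A.
Proof.
rewrite inE; case: (bary_cayley x) => [[g ->]|[g [h [gh [t t01 <-]]]]].
  by left; exists (k * g)%g; apply/funext => v; rewrite /vertex_point eq_mulVg.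
right; exists (k * g)%g, (k * h)%g; rewrite cayley_adjacent_translate; split=> //.
by exists t => //; apply/funext => v; rewrite edge_point_translate.
Qed.

(** Left multiplication by [k]: the weight at a vertex [v] moves to [k * v]. *)
Definition translate k x : X := CayleyPoint genA (translate_subproof k x).

Lemma pl_length_translate k x y l :
  pl_length x y l -> pl_length (translate k x) (translate k y) l.
Proof.
elim=> {x y l} [x|x y z g h l gh [s s01 xs] [t t01 yt] _ IH]; first exact: pl_nil.
have -> : `|bary x g - bary y g| =
    `|bary (translate k x) (k * g)%g - bary (translate k y) (k * g)%g|.
  by rewrite /= mulKg.
apply: (pl_step (h := (k * h)%g) _ _ _ IH).
- by rewrite cayley_adjacent_translate.
- by exists s => //; apply/funext => v; rewrite /= -xs edge_point_translate.
- by exists t => //; apply/funext => v; rewrite /= -yt edge_point_translate.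
Qed.

Lemma translateK k x : translate k^-1 (translate k x) = x.
Proof.
by apply: val_inj; apply/funext => v /=; rewrite invgK mulKg.
Qed.

Lemma mdist_translate k x y : mdist (translate k x) (translate k y) = mdist x y.
Proof.
apply/eqP; rewrite eq_le; apply/andP; split; apply: cayley_dist_ge => l Hl.
  exact/mdist_pl/pl_length_translate.
by rewrite -(translateK k x) -(translateK k y); exact/mdist_pl/pl_length_translate.
Qed.

End CayleyMetric.

(** * Edge paths of words *)

Section WordPath.
Context (R : realType) (G : groupType) (A : {fset G}).
Hypotheses (symA : symmetric_subset A) (genA : generates A).
Local Notation wl := (word_length symA genA).
Local Notation path := (@word_path R G A genA).
Implicit Types (v w : seq A) (s t : R).

(** At the right end of the edge the truncation of [t] is already [i.+1], but both formulas give the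
    same vertex. *)
Lemma word_path_edge w i t : (i < size w)%N -> i%:R <= t <= i.+1%:R ->
  bary (path w t) = edge_point (word_vertex w i) (word_vertex w i.+1) (t - i%:R).
Proof.
move=> iw /andP[it ti]; rewrite word_pathE; last first.
  rewrite (le_trans _ it)//=; apply: le_trans ti _.
  by rewrite ler_nat.
have [lt_ti|ge_ti] := ltP t i.+1%:R.
  by rewrite (@truncn_def _ _ i)// it.
have -> : t = i.+1%:R by apply/eqP; rewrite eq_le ti.
rewrite (@truncn_def _ _ i.+1) ?lexx ?ltr_nat ?ltnSn//.
by rewrite subrr edge_point0 -natr1 addrAC subrr add0r edge_point1.
Qed.

Lemma word_path_nat w i : (i <= size w)%N ->
  path w i%:R = vertex R genA (word_vertex w i).
Proof.
move=> iw; apply: val_inj; rewrite /= word_pathE ?ler0n ?ler_nat//.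
by rewrite (@truncn_def _ _ i) ?lexx ?ltr_nat ?ltnSn// subrr edge_point0.
Qed.

Lemma word_path0 w : path w 0 = vertex R genA 1%g.
Proof. by rewrite -[0]/(0%:R) word_path_nat// /word_vertex take0 big_nil. Qed.

Lemma word_path_size w : path w (size w)%:R = vertex R genA (word_val w).
Proof. by rewrite word_path_nat// /word_vertex take_size. Qed.

Lemma word_path_catl v w t : 0 <= t <= (size v)%:R -> path (v ++ w) t = path v t.
Proof.
move=> /andP[t0 tv].
have tvw : 0 <= t <= (size (v ++ w))%:R.
  by rewrite t0 (le_trans tv)// ler_nat size_cat leq_addr.
apply: val_inj; rewrite /= (word_pathE _ tvw) word_pathE ?t0//.
have /andP[it ti] := truncn_itv t0; move: it ti; set i := Num.truncn t => it ti.
have iv : (i <= size v)%N by rewrite -(ler_nat R) (le_trans it).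
have vertE j : (j <= size v)%N -> word_vertex (v ++ w) j = word_vertex v j.
  by move=> jv; rewrite /word_vertex takel_cat.
(* At [t = size v] the next vertices of the two words may differ, but the edge parameter is 0
   there. *)
move: iv; rewrite leq_eqVlt => /predU1P[iv|iv]; last by rewrite !vertE// ltnW.
have -> : t - i%:R = 0 by apply/eqP; rewrite subr_eq0 eq_le it iv tv.
by rewrite !edge_point0 vertE// iv.
Qed.

Lemma word_path_catr v w t : 0 <= t <= (size w)%:R ->
  path (v ++ w) (t + (size v)%:R) = translate (word_val v) (path w t).
Proof.
move=> /andP[t0 tw]; apply: val_inj; apply/funext => u /=.
rewrite !word_pathE ?t0 ?addr_ge0//=; last by rewrite size_cat natrD addrC lerD2l.
rewrite edge_point_translate.
have /andP[it ti] := truncn_itv t0.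
rewrite (@truncn_def _ (t + _) (size v + Num.truncn t)); last first.
  by rewrite -addnS !natrD addrC lerD2r it /= addrC ltrD2l.
rewrite natrD addrKA.
have vertE j : word_vertex (v ++ w) (size v + j) = (word_val v * word_vertex w j)%g.
  by rewrite /word_vertex takeD take_size_cat// drop_size_cat// big_cat.
by rewrite -addnS !vertE.
Qed.

Lemma word_path_lipschitz w s t : 0 <= s -> s <= t -> t <= (size w)%:R ->
  mdist (path w s) (path w t) <= t - s.
Proof.
(* Induction on an integer bound of [t], so that only the last edge is new. *)
move=> s0 st tw; have [m] : exists m, t <= m%:R by exists (size w).
elim: m t st tw => [|m IH] t st tw tm.
  have -> : s = t by lra.
  by rewrite mdistxx subrr.
have [tm'|mt] := leP t m%:R; first exact: IH.
have mw : (m < size w)%N by rewrite -(ltr_nat R); apply: lt_le_trans tw.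
have edge r : m%:R <= r -> r <= t -> mdist (path w r) (path w t) <= t - r.
  move=> mr rt; rewrite -[leRHS](@ger0_norm R) ?subr_ge0// distrC.
  rewrite (_ : r - t = (r - m%:R) - (t - m%:R)); last by ring.
  rewrite -natr1 in tm.
  apply: (@mdist_edge R G A genA _ _ (word_vertex w m) (word_vertex w m.+1)).
  - case: w tw mw {IH} => [//|a0 w] tw mw.
    rewrite /cayley_adjacent /word_vertex (take_nth a0)// -cats1 big_cat big_seq1 /=.
    by rewrite mulKg; exact: valP.
  - by apply: word_path_edge => //; rewrite -natr1; lra.
  - by apply: word_path_edge => //; rewrite -natr1; lra.
  - lra.
  - lra.
have [ms|sm] := leP m%:R s; first exact: edge.
have := metric_triangle (path w s) (path w m%:R) (path w t).
have := edge m%:R (lexx _) (ltW mt).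
have : mdist (path w s) (path w m%:R) <= m%:R - s.
  by apply: IH => //; [exact: ltW|rewrite (le_trans (ltW mt))].
lra.
Qed.

(** A 1-Lipschitz path whose ends are as far apart as its length cannot lose distance on any
    subsegment. *)
Lemma geodesic_word_path w :
  geodesic (path w) (size w)%:R <-> wl (word_val w) = size w.
Proof.
have dw : mdist (path w 0) (path w (size w)%:R) = (wl (word_val w))%:R.
  by rewrite word_path0 word_path_size mdist_vertex invg1 mul1g.
split=> [gw|wlw s t].
  apply/eqP; rewrite -(eqr_nat R) -dw gw ?lexx ?ler0n//.
  by rewrite sub0r normrN ger0_norm.
wlog st : s t / s <= t => [H|].
  have [|/ltW ts] := leP s t; first exact: H.
  by move=> sw tw; rewrite metric_sym distrC; apply: H.
move=> /andP[s0 sw] /andP[t0 tw]; rewrite distrC ger0_norm ?subr_ge0//.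
rewrite wlw in dw.
have := metric_triangle (path w 0) (path w s) (path w (size w)%:R).
have := metric_triangle (path w s) (path w t) (path w (size w)%:R).
have := word_path_lipschitz (lexx 0) s0 sw.
have := word_path_lipschitz s0 st tw.
have := word_path_lipschitz t0 tw (lexx _).
rewrite dw => *; apply/eqP; rewrite eq_le; apply/andP; split; lra.
Qed.

End WordPath.

(** * Closure properties and residuals of the language *)

Section Language.
Context (R : realType) (G : groupType) (A : {fset G}).
Hypotheses (symA : symmetric_subset A) (genA : generates A).
Context (D : R).
Local Notation wl := (word_length symA genA).
Local Notation path := (@word_path R G A genA).
Local Notation L := (super_contracting_language genA D).
Implicit Types (u v w x : seq A) (a : A).

Lemma languageP w :
  L w <-> wl (word_val w) = size w /\ super_contracting D (path w) (size w)%:R.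
Proof. by rewrite -(geodesic_word_path R symA). Qed.

Lemma word_length_infix u v w :
  wl (word_val (u ++ v ++ w)) = size (u ++ v ++ w) -> wl (word_val v) = size v.
Proof.
rewrite !word_val_cat !size_cat => uvw.
have := word_lengthM symA genA (word_val u) (word_val v * word_val w)%g.
have := word_lengthM symA genA (word_val v) (word_val w).
have := word_length_le symA genA u; have := word_length_le symA genA v.
have := word_length_le symA genA w; lia.
Qed.

Lemma language_prefix v w : L (v ++ w) -> L v.
Proof.
move=> /languageP[gvw sc]; apply/languageP; split.
  exact: (@word_length_infix [::] v w).
apply: (@super_contracting_eq _ _ _ (path (v ++ w))).
  exact: word_path_catl.
move=> a b a0 ab bv; apply: sc => //.
by rewrite (le_trans bv)// ler_nat size_cat leq_addr.
Qed.

(** Translation by [word_val v] would carry an obstruction for [w] to one for [v ++ w]. *)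
Lemma language_suffix v w : L (v ++ w) -> L w.
Proof.
move=> [/[dup] gvw /(geodesic_word_path R symA) lvw sc].
have gw : geodesic (path w) (size w)%:R.
  by apply/(geodesic_word_path R symA)/(@word_length_infix v w [::]); rewrite cats0.
split => //; apply/(super_contractingP _ gw) => a b a0 ab bw Dab.
move=> /(@obstruction_transport _ _ _ _ (path (v ++ w)) _ _ (size v)%:R
  (mdist_translate (word_val v)) ab) ob.
move: sc => /(super_contractingP _ gvw); apply; last first.
  by apply: ob => t tab; apply: word_path_catr; lra.
all: rewrite ?size_cat ?natrD; have := ler0n R (size v); lra.
Qed.

Hypothesis D0 : 0 <= D.

(** New obstructions of length at most 3D + 10 end in the edge of [a]. With 1 more for that edge
    they lie within [x], where they are excluded. *)
Lemma language_extend v w x a : rcons w a = v ++ x -> L w -> L x ->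
  v = [::] \/ D *+ 3 + 11 <= (size x)%:R ->
  wl (word_val (rcons w a)) = size (rcons w a) -> L (rcons w a).
Proof.
move=> wavx Lw Lx long lwa; apply/languageP; split=> //.
have gwa : geodesic (path (rcons w a)) (size (rcons w a))%:R.
  exact/(geodesic_word_path R symA).
have sz : (size (rcons w a))%:R = (size w)%:R + 1 :> R by rewrite size_rcons natr1.
apply: (super_contracting_extend (cayley_coarsely_geodesic (genA := genA))
  gwa D0 (l' := (size w)%:R)); rewrite ?sz ?lerDl//.
  apply: (@super_contracting_eq _ _ _ (path w)); last by case: Lw.
  by move=> t tw; rewrite -cats1 word_path_catl.
move=> p q p0 pq qw wq Dpq short ob.
have szvx : (size w)%:R + 1 = (size v)%:R + (size x)%:R :> R.
  by rewrite -sz wavx size_cat natrD.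
have vp : (size v)%:R <= p by case: long => [->//|]; lra.
case: Lx => gx /(super_contractingP _ gx).
apply; last apply: (@obstruction_transport _ _ (translate (word_val v)^-1)
  (path (v ++ x)) _ p q (- (size v)%:R)).
- lra.
- lra.
- lra.
- lra.
- exact: mdist_translate.
- by [].
- move=> t tpq; rewrite -{2}(subrK (size v)%:R t) word_path_catr ?translateK//; lra.
- by rewrite -wavx.
Qed.

(** The reverse triangle inequality towards both ends of [v] locates the projection of the vertex of
    [w]. The index shift later provides the strict inequality in [cone_tail]. *)
Lemma fellow_travel v w i : L v -> (size w <= size v)%N -> (i < size v)%N ->
  (wl ((word_val v)^-1 * word_val w)%g <= 1)%N ->
  (wl ((word_vertex v i.+1)^-1 * word_vertex w i)%g)%:R <= D *+ 2 + 10.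
Proof.
move=> [gv scv] wv iv vw.
set y := vertex R genA (word_vertex w i).
have y0 : mdist y (path v 0) <= i%:R.
  rewrite word_path0 metric_sym mdist_vertex invg1 mul1g ler_nat.
  by apply: leq_trans (word_length_le _ _ _) _; rewrite size_take_min geq_minl.
have y1 : mdist y (path v (size v)%:R) <= (size v)%:R - i%:R + 1.
  apply: le_trans (metric_triangle _ (vertex R genA (word_val w)) _) _.
  rewrite word_path_size (metric_sym _ (vertex R genA (word_val v))) !mdist_vertex.
  rewrite lerD ?(ler_nat _ _ 1)// -natrB; last exact: ltnW.
  rewrite ler_nat -{2}(cat_take_drop i w) word_val_cat mulKg.
  by apply: leq_trans (word_length_le _ _ _) _; rewrite size_drop leq_sub2r.
have v0 := ler0n R (size v).
have [s [sv ys]] := geodesic_proj_point y gv (lexx 0) v0 (lexx _).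
have tri r : 0 <= r <= (size v)%:R -> _ := fun rv => contracting_reverse_triangle
  (cayley_coarsely_geodesic (genA := genA)) gv scv D0 (lexx 0) v0 (lexx _) rv ys.
have := tri 0; have := tri (size v)%:R.
rewrite !lexx v0 => /(_ isT) tri1 /(_ isT) tri0.
have iv' : 0 <= (i.+1%:R : R) <= (size v)%:R by rewrite ler0n ler_nat.
have := metric_triangle (path v i.+1%:R) (path v s) y.
rewrite (metric_sym (path v s)) {1}word_path_nat// {1}/y (mdist_vertex R symA) => yi.
apply: le_trans yi _.
move: tri0 tri1; rewrite !gv ?lexx ?v0// subr0.
rewrite (ger0_norm (x := s)); last lra.
rewrite (distrC s) (ger0_norm (x := _ - s)); last lra.
move=> tri0 tri1.
(* The estimate at the start of [v] bounds [s] from above, the one at its end from below; the latter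
   gives 2D + 10. *)
have : `|i.+1%:R - s| <= D *+ 2 + 10 - mdist y (path v s).
  by rewrite ler_distl -natr1; lra.
lra.
Qed.

(* Cannon's argument: if appending [a] made [w' ++ u] non-geodesic, a shortest
   word to the new endpoint would pass at distance [size w' - 1] from the
   identity through a point that differs from the endpoint of [w'] by an element
   of the tail. The tail of [w] containing this element too, [rcons (w ++ u) a]
   would not be geodesic either. *)
Lemma cone_tail_geodesic K w w' u a : D *+ 2 + 10 <= K%:R ->
  L (w' ++ u) -> w' != [::] ->
  cone_tail symA genA K w = cone_tail symA genA K w' -> wl (word_val w') = size w' ->
  wl (word_val (rcons (w ++ u) a)) = size (rcons (w ++ u) a) ->
  wl (word_val (rcons (w' ++ u) a)) = size (rcons (w' ++ u) a).
Proof.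
move=> DK Lw'u w'0 tails lw' lwu.
apply/eqP; rewrite eqn_leq word_length_le leqNgt; apply/negP => short.
have [b [bval bsz]] := word_lengthP symA genA (word_val (rcons (w' ++ u) a)).
rewrite -bsz size_rcons ltnS in short.
have w'gt0 : (0 < size w')%N by rewrite lt0n size_eq0.
(* Stopping [b] one letter before [size w'] gives a vertex strictly closer to the identity than the
   endpoint of [w']. *)
pose i := (size w').-1; have iw' : i.+1 = size w' by rewrite prednK.
have iw'u : (i < size (w' ++ u))%N by rewrite size_cat -iw' addSn ltnS leq_addr.
have := fellow_travel Lw'u short iw'u.
rewrite iw' {1}/word_vertex take_size_cat// bval word_val_rcons mulKg.
move=> /(_ (word_length_gen symA genA (valP a))) hK.
rewrite -/(word_val w') in hK.
have [h [hval hsz]] := word_lengthP symA genA ((word_val w')^-1 * word_vertex b i)%g.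
have {}hK : (size h <= K)%N.
  by rewrite hsz -(ler_nat R) (le_trans hK).
have := congr1 (fun f : {ffun _ -> _} => f (Bseq hK)) tails; rewrite !ffunE /= hval.
rewrite mulVKg lw' -iw' ltnS.
have -> : (wl (word_vertex b i) <= i)%N.
  by apply: leq_trans (word_length_le _ _ _) _; rewrite size_take_min geq_minl.
move=> wh.
have ua : (word_val u * val a =
    (word_val w')^-1 * word_vertex b i * word_val (drop i b))%g.
  rewrite -mulgA /word_vertex -/(word_val _) -word_val_cat cat_take_drop bval.
  by rewrite word_val_rcons word_val_cat -mulgA mulKg.
(* The detour has length at most |w| - 1 up to [h] and |u| + 1 along the rest of [b], which is less
   than the length |w| + |u| + 1 of the geodesic word. *)
have := word_lengthM symA genA
  (word_val w * ((word_val w')^-1 * word_vertex b i))%g (word_val (drop i b)).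
rewrite -mulgA -ua mulgA -word_val_cat -word_val_rcons lwu.
have := word_length_le symA genA (drop i b); have := word_length_le symA genA w.
rewrite size_drop; move: short wh iw'; rewrite !size_rcons !size_cat; lia.
Qed.

(** Induction on [u] from the right: the tails keep the extended word geodesic, and the common last
    [N] letters followed by [u] keep it contracting. *)
Lemma same_residual K N w w' u :
  D *+ 2 + 10 <= K%:R -> D *+ 3 + 11 <= N%:R ->
  drop (size w - N) w = drop (size w' - N) w' ->
  cone_tail symA genA K w = cone_tail symA genA K w' ->
  L w -> L w' -> L (w ++ u) -> L (w' ++ u).
Proof.
move=> DK DN suf tails Lw Lw'.
have [w'0|w'0] := eqVneq w' [::].
  (* An empty word is recognised by its suffix, since [N] is positive. *)
  have := congr1 size suf; rewrite w'0 !size_drop /= => w0.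
  have -> : w = [::].
    apply: size0nil.
    have N0 : (0 < N)%N.
      by rewrite -(ltr_nat R) (lt_le_trans _ DN)// ltr_wpDl// mulrn_wge0.
    lia.
  by [].
elim/last_ind: u => [|u a IH]; rewrite ?cats0// -!rcons_cat => Lwua.
have Lwu : L (w ++ u) by apply: (@language_prefix _ [:: a]); rewrite cats1.
have {IH}Lw'u := IH Lwu.
apply: (@language_extend (take (size w' - N) w') _
  (drop (size w' - N) w' ++ rcons u a)) => //.
- by rewrite rcons_cat catA cat_take_drop.
- apply: (@language_suffix (take (size w - N) w)).
  by rewrite -suf catA cat_take_drop -rcons_cat.
- have [w'N|Nw'] := leqP (size w') N.
    by left; rewrite (_ : _ - _ = 0)%N ?take0//; lia.
  right; rewrite (le_trans DN)// ler_nat size_cat size_drop; lia.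
- apply: (@cone_tail_geodesic K w) => //; first by case/languageP: Lw'.
  by case/languageP: Lwua.
Qed.

End Language.

(** * From finitely many residuals to an automaton *)

(** As in the Myhill-Nerode theorem, keys are the states. A key need not determine the key after one
    more letter, so transitions use all representatives and the automaton may be
    nondeterministic. *)
Lemma regular_of_residuals (T Q : finType) (L : set (seq T)) (key : seq T -> Q) :
  (forall w w' u, key w = key w' -> L (w ++ u) -> L (w' ++ u)) ->
  regular_language L.
Proof.
move=> keyL.
pose M := @Automaton T Q
  (fun q a q' => `[< exists2 w, key w = q & key (rcons w a) = q' >])
  (key [::]) (fun q => `[< exists2 w, L w & key w = q >]).
exists M; apply/seteqP; split => w /=.
  move=> Lw; exists (key w); first by apply/asboolP; exists w.
  suff : forall v, labels_path (key v : state M) w (key (v ++ w)) by move/(_ [::]).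
  elim: w {Lw} => [|a w IH] v /=; first by rewrite cats0.
  by exists (key (rcons v a)); [apply/asboolP; exists v|rewrite -cat_rcons].
case=> q /asboolP[v Lv <-].
(* At each letter of the run the prefix may be replaced by another with the same key, since this
   does not affect which extensions lie in [L]. *)
suff : forall u, labels_path (key u : state M) w (key v) -> L (u ++ w).
  by move/(_ [::]).
elim: w => [|a w IH] u /=.
  by move=> uv; apply: keyL (esym uv) _; rewrite cats0.
case=> q' /asboolP[u' u'u <-] /IH Lu'aw.
by apply: keyL u'u _; rewrite -cat_rcons.
Qed.

Fact suffix_subproof (T : Type) N (w : seq T) : (size (drop (size w - N) w) <= N)%N.
Proof. by rewrite size_drop; lia. Qed.

Theorem theorem1p2 (R : realType) (G : groupType) (A : {fset G})
    (symA : symmetric_subset A) (genA : generates A) (D : R) (hD : 0 <= D) :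
  regular_language (super_contracting_language genA D).
Proof.
set L := super_contracting_language genA D.
have [K DK] : exists K, D *+ 2 + 10 <= K%:R.
  by exists (Num.truncn (D *+ 2 + 10)).+1; exact/ltW/truncnS_gt.
have [N DN] : exists N, D *+ 3 + 11 <= N%:R.
  by exists (Num.truncn (D *+ 3 + 11)).+1; exact/ltW/truncnS_gt.
(* All words outside [L] share one key: [L] is closed under prefixes, so none of their extensions
   lies in [L]. *)
pose key w := if `[< L w >] then
  Some (Bseq (suffix_subproof N w), cone_tail symA genA K w) else None.
apply: (regular_of_residuals (key := key)) => w w' u kk' Lwu.
have Lw : L w := language_prefix symA Lwu.
move: kk'; rewrite /key (asboolT Lw); case: asboolP => // Lw' [suf tails].
exact: (same_residual hD DK DN suf tails Lw Lw' Lwu).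
Qed.
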